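(* Let $G=(V,E)$ be a graph containing a cycle and let $x$ be an extreme point of the edge strong density polyhedron $P_{\mathrm{Edge\text{-}SD}}(G)$. Then there exists $u\in V$ such that $x_u\ge 1/2$.
   Context: Graphs are finite, undirected, simple and loopless. For $F\subseteq E$, $V(F)$ is the set of vertices incident to at least one edge of $F$, and $d_F(u)$ is the degree of $u$ in the graph $(V(F),F)$. The edge strong density polyhedron is $$P_{\mathrm{Edge\text{-}SD}}(G)=\Big\{x\in[0,1]^V:\ \sum_{u\in V(F)}(d_F(u)-1)x_u\ \ge\ |F|-|V(F)|+1\quad\text{for all } \emptyset\neq F\subseteq E\Big\}.$$ *)

(* Defs.v *)
From mathcomp Require Import all_boot all_order all_algebra.
From mathcomp Require Import reals.

Set Implicit Arguments.
Unset Strict Implicit.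
Unset Printing Implicit Defensive.

Import Order.TTheory GRing.Theory Num.Theory.

Local Open Scope ring_scope.

Section Graph.
Variable V : finType.
Implicit Types (e : rel V) (F : {set {set V}}).

(* [ucycle e] also holds of [::] and of [:: u; v] for an edge uv, hence the
   bound on the length. *)
Definition has_cycle e := exists2 p : seq V, (2 < size p)%N & ucycle e p.

Definition edge_set e : {set {set V}} :=
  [set f : {set V} | [exists u, exists v, e u v && (f == [set u; v])]].

Definition edge_deg F (u : V) : nat := #|[set f in F | u \in f]|.

End Graph.

(* The vertex set V(F) of the subgraph spanned by F is [cover F].
   The codomain is R^o only to make {ffun V -> R^o} an R-module. *)
Definition edge_SD_polyhedron (R : realType) (V : finType) (e : rel V)
    (x : {ffun V -> R^o}) : Prop :=
  (forall u : V, 0 <= (x u : R) <= 1) /\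
  (forall F : {set {set V}}, F != set0 -> F \subset edge_set e ->
    \sum_(u in cover F) ((edge_deg F u)%:R - 1) * (x u : R) >=
      #|F|%:R - #|cover F|%:R + 1).

Definition extreme_point (R : realType) (E : lmodType R) (A : E -> Prop) (x : E) :=
  A x /\ forall (y z : E) (t : R), A y -> A z -> 0 < t < 1 ->
    x = t *: y + (1 - t) *: z -> y = x /\ z = x.

(* Main.v *)
(* Suppose that x is an extreme point with all entries below 1/2, so that every
   edge uv has weight 1 - x_u - x_v > 0 and every vertex has weight
   1 - x_v > 1/2.  The constraint of F says that the edge weight of F is at most
   the vertex weight of V(F) minus 1.  Positivity of the edge weights forces the
   tight F to be the edge sets of induced subgraphs, and two tight vertex sets
   sharing at least two vertices uncross.  Let U be a maximal vertex set
   containing a cycle in which every zero of x has degree at least two, and L a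
   maximal cross-free family of tight subsets of U.  Two members of L that are
   maximal inside a larger one share at most one vertex, and comparing weights,
   with 1 - x_v > 1/2, shows that L yields fewer independent equations than U has
   vertices with x_v > 0.  Hence some d != 0 supported on these vertices
   preserves all tight constraints, and both x + eps d and x - eps d lie in the
   polyhedron. *)

Require Import Defs.
From mathcomp Require Import all_boot all_order all_algebra.
From mathcomp Require Import reals.
From mathcomp Require Import ring lra zify.

Set Implicit Arguments.
Unset Strict Implicit.
Unset Printing Implicit Defensive.

Import Order.TTheory GRing.Theory Num.Theory.

Local Open Scope ring_scope.

(** * Linear algebra: step sizes and kernel vectors *)

(** Meant for slacks [a] and their rates of change [b] along a direction: one step size then keeps
    all constraints valid both ways. *)
Lemma exists_common_scale (R : realFieldType) (I : finType) (a b : I -> R) :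
  (forall i, 0 <= a i) -> (forall i, a i = 0 -> b i = 0) ->
  exists2 eps : R, 0 < eps & forall i, eps * `|b i| <= a i.
Proof.
move=> a_ge0 ab0.
have [eps eps_gt0 /allP le_a] :
    exists2 eps : R, 0 < eps & all (fun i => eps * `|b i| <= a i) (enum I).
  elim: (enum I) => [|i s [eps eps_gt0 IH]]; first by exists 1.
  have [t t_gt0 ht] : exists2 t : R, 0 < t & t * `|b i| <= a i.
    have [ai0|ai_neq0] := eqVneq (a i) 0.
      by exists 1 => //; rewrite ab0 // ai0 normr0 mulr0.
    have ai_gt0 : 0 < a i by rewrite lt_def ai_neq0 a_ge0.
    (* For [b i = 0] the bare quotient would be 0 and not positive, hence the [+ 1]. *)
    exists (a i / (`|b i| + 1)); first by rewrite divr_gt0 // ltr_wpDl.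
    by rewrite mulrAC ler_pdivrMr ?ltr_wpDl // ler_pM2l // lerDl.
  exists (Num.min eps t); first by rewrite lt_min eps_gt0.
  rewrite /= (le_trans _ ht) ?ler_wpM2r // ?ge_min ?lexx ?orbT //=.
  by apply: sub_all IH => j; apply: le_trans; rewrite ler_wpM2r // ge_min lexx.
by exists eps => // i; apply: le_a; rewrite mem_enum.
Qed.

(** With fewer equations than unknowns, the coefficient matrix with rows indexed by [D] has a
    nonzero left kernel vector, which is extended by zero off [D]. *)
Lemma exists_supported_kernel (R : fieldType) (V I : finType) (D : {set V})
    (K : {set I}) (l : I -> V -> R) :
  (#|K| < #|D|)%N ->
  exists d : V -> R, [/\ exists v, d v != 0, forall v, v \notin D -> d v = 0
    & forall S, S \in K -> \sum_v d v * l S v = 0].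
Proof.
move=> ltKD.
pose M : 'M[R]_(#|D|, #|K|) := \matrix_(i, j) l (enum_val j) (enum_val i).
have : kermx M != 0.
  rewrite -mxrank_eq0 mxrank_ker subn_eq0 -ltnNge.
  exact: leq_ltn_trans (rank_leq_col M) ltKD.
case/rowV0Pn => u /sub_kermxP uM u_neq0.
have [i0 ui0] : exists i, u 0 i != 0.
  apply/existsP; rewrite -[X in is_true X]negbK negb_exists.
  apply: contra u_neq0 => /forallP u0; apply/eqP/rowP => i.
  by rewrite mxE; apply/eqP; rewrite -[_ == _]negbK u0.
exists (fun v => \sum_i u 0 i *+ (enum_val i == v)); split.
- exists (enum_val i0); rewrite (bigD1 i0) //= eqxx big1 ?addr0 // => i ne.
  by rewrite (inj_eq enum_val_inj) (negPf ne).
- move=> v vD; rewrite big1 // => i _; case: eqP => // iv.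
  by move: vD; rewrite -iv enum_valP.
- move=> S SK; have := congr1 (fun N : 'M_(1, _) => N 0 (enum_rank_in SK S)) uM.
  rewrite !mxE => uMS; apply: etrans uMS.
  under eq_bigr do rewrite mulr_suml.
  rewrite exchange_big; apply: eq_bigr => i _ /=.
  rewrite (bigD1 (enum_val i)) //= eqxx mxE enum_rankK_in // big1 ?addr0 // => v.
  by rewrite eq_sym => /negPf ->; rewrite mul0r.
Qed.

(** * Noncrossing families and their tree structure *)

Section NoncrossingFamily.

Variable V : finType.
Implicit Types (S T A C : {set V}) (L : {set {set V}}).

(** Overlaps of at most one vertex do not count, because uncrossing needs an intersection with at
    least two vertices. *)
Definition cross S T := [&& 1 < #|S :&: T|, ~~ (S \subset T) & ~~ (T \subset S)]%N.

Lemma crossC S T : cross S T = cross T S.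
Proof. by rewrite /cross setIC; congr (_ && _); rewrite andbC. Qed.

Definition noncrossing L := [forall S in L, forall T in L, ~~ cross S T].

(** [A] need not belong to [L], so that [U] has children too. *)
Definition children L A := [set C | maxset (fun S => (S \in L) && (S \proper A)) C].

Lemma childrenP L A C : C \in children L A -> C \in L /\ C \proper A.
Proof. by rewrite inE => /maxsetp/andP. Qed.

Lemma exists_child L A S : S \in L -> S \proper A ->
  exists2 C, C \in children L A & S \subset C.
Proof.
move=> SL SA.
have [|C maxC SC] := @maxset_exists _ (fun S => (S \in L) && (S \proper A)) S.
  by rewrite SL.
by exists C; rewrite ?inE.
Qed.

(** Distinct children are incomparable by maximality; being noncrossing, they share at most one
    vertex, too few to hold [S]. *)
Lemma child_uniq L A S C D : noncrossing L -> (1 < #|S|)%N ->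
  C \in children L A -> D \in children L A -> S \subset C -> S \subset D -> C = D.
Proof.
move=> ncL S1 chC chD SC SD; have [CL _] := childrenP chC.
have [DL _] := childrenP chD.
have /forall_inP/(_ D DL) := forall_inP ncL C CL.
rewrite /cross (leq_trans S1) /=; last by rewrite subset_leq_card // subsetI SC.
move: chC chD; rewrite !inE => /maxsetP[pC maxC] /maxsetP[pD maxD].
rewrite -negb_or negbK => /orP[CD|DC].
  by rewrite (maxC D).
by rewrite (maxD C).
Qed.

(** Each member strictly inside [A] lies below exactly one child. *)
Lemma sum_children (M : nmodType) L A (b : {set V} -> M) :
  noncrossing L -> (forall S, S \in L -> (1 < #|S|)%N) ->
  \sum_(S in L | S \proper A) b S =
  \sum_(C in children L A) \sum_(S in L | S \subset C) b S.
Proof.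
move=> ncL L1; rewrite (exchange_big_dep (fun S => (S \in L) && (S \proper A))) /=.
  apply: eq_bigr => S /andP[SL SA]; have [C chC SC] := exists_child SL SA.
  rewrite (big_pred1 C) // => D; rewrite SL /=.
  apply/andP/eqP => [[chD SD]|->]; last by [].
  exact: child_uniq ncL (L1 _ SL) chD chC SD SC.
move=> C S chC /andP[-> SC] /=; have [_ CA] := childrenP chC.
exact: sub_proper_trans SC CA.
Qed.

Definition multiplicity L A v := #|[set C in children L A | v \in C]|.

Lemma multiplicity_gt0 L A v :
  (0 < multiplicity L A v)%N = (v \in cover (children L A)).
Proof.
apply/card_gt0P/bigcupP => [[C]|[C chC vC]]; last by exists C; rewrite inE chC.
by rewrite inE => /andP[]; exists C.
Qed.

Lemma sum_cover_children (M : nmodType) L A (a : V -> M) :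
  \sum_(C in children L A) \sum_(v in C) a v =
  \sum_(v in cover (children L A)) a v *+ multiplicity L A v.
Proof.
rewrite (exchange_big_dep (fun v => v \in cover (children L A))) /=.
  apply: eq_bigr => v _; rewrite sumr_const; congr (_ *+ _).
  by apply: eq_card => C; rewrite inE.
by move=> C v chC vC; apply/bigcupP; exists C.
Qed.

End NoncrossingFamily.

(** * Slacks of the constraints and tight vertex sets *)

Section Gap.

Variables (R : realFieldType) (V : finType) (E : {set {set V}}).
Hypothesis E2 : forall f, f \in E -> #|f| = 2%N.
Implicit Types (S T A : {set V}) (F : {set {set V}}) (x d : V -> R).

Definition induced S := [set f in E | f \subset S].

(** For [S = cover F] this is the slack of the constraint of [F]; a free [S] allows vertices that no
    edge of [F] meets. *)
Definition gap x S F :=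
  \sum_(v in S) (1 - x v) - \sum_(f in F) (1 - \sum_(u in f) x u) - 1.

(** Minus the derivative of [gap] along [d]. *)
Definition linear_gap d S F :=
  \sum_(v in S) d v - \sum_(f in F) \sum_(u in f) d u.

Lemma gap_shift x d eps S F :
  gap (fun v => x v + eps * d v) S F = gap x S F - eps * linear_gap d S F.
Proof.
rewrite /gap /linear_gap.
under eq_bigr do rewrite opprD addrA.
rewrite big_split /=.
under [X in _ - X - _]eq_bigr do rewrite big_split /= opprD addrA.
rewrite [X in _ - X - _]big_split /= !sumrN -mulr_sumr.
under [X in _ - (_ - X) - _]eq_bigr do rewrite -mulr_sumr.
by rewrite -mulr_sumr; ring.
Qed.

Lemma inducedS S T : S \subset T -> induced S \subset induced T.
Proof.
move=> ST; apply/subsetP => f; rewrite !inE => /andP[-> fS].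
exact: subset_trans fS ST.
Qed.

Lemma inducedI S T : induced (S :&: T) = induced S :&: induced T.
Proof. by apply/setP => f; rewrite !inE subsetI; case: (f \in E). Qed.

Lemma induced_sub S : induced S \subset E.
Proof. by apply/subsetP => f; rewrite inE => /andP[]. Qed.

Lemma cover_induced_sub S : cover (induced S) \subset S.
Proof. by apply/bigcupsP => f; rewrite inE => /andP[]. Qed.

Lemma edge_eq S f : f \in induced S -> (#|S| <= 2)%N -> f = S.
Proof.
rewrite inE => /andP[fE fS] S2; apply/eqP.
by rewrite eqEcard fS (E2 fE).
Qed.

Lemma induced_edge f : f \in E -> induced f = [set f].
Proof.
move=> fE; apply/setP => h; rewrite in_set1; apply/idP/eqP => [hf|->].
  by apply: edge_eq hf _; rewrite E2.
by rewrite inE fE subxx.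
Qed.

(** The slack of a single edge is 0 whatever [x] is, so edges impose no equation on directions. *)
Lemma linear_gap_edge d f : f \in E -> linear_gap d f (induced f) = 0.
Proof. by move=> fE; rewrite /linear_gap induced_edge // big_set1 subrr. Qed.

Variable x : V -> R.
Hypothesis x_ge0 : forall v, 0 <= x v.
Hypothesis x_lt : forall v, x v < 1 / 2.
Hypothesis cover_gap_ge0 : forall F, F != set0 -> F \subset E ->
  0 <= gap x (cover F) F.

Lemma sum_lt1 S : (#|S| <= 2)%N -> S != set0 -> \sum_(v in S) x v < 1.
Proof.
move=> S2 /set0Pn[u uS].
have : \sum_(v in S) x v < \sum_(v in S) (1 / 2).
  apply: ltr_sum => [|v _]; last exact: x_lt.
  by apply/hasP; exists u; rewrite ?mem_index_enum.
rewrite sumr_const => /lt_le_trans; apply.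
have : (#|S|%:R : R) <= 2 by rewrite ler_nat.
by rewrite -mulr_natr; lra.
Qed.

Lemma weight_gt0 f : f \in E -> 0 < 1 - \sum_(u in f) x u.
Proof.
move=> fE; rewrite subr_gt0 sum_lt1 ?E2 //.
by rewrite -card_gt0 E2.
Qed.

Lemma sum_weight_sub F F' : F \subset F' -> F' \subset E ->
  \sum_(f in F) (1 - \sum_(u in f) x u) <= \sum_(f in F') (1 - \sum_(u in f) x u)
  ?= iff (F == F').
Proof.
move=> FF' F'E; rewrite (big_setID F (A := F')) /= (setIidPr FF').
rewrite -[X in X <= _ ?= iff _]addr0.
have -> : (F == F') = (F' :\: F == set0) by rewrite setD_eq0 eqEsubset FF'.
split; last first.
  rewrite (inj_eq (addrI _)) eq_sym.
  apply/eqP/eqP => [|->]; last by rewrite big_set0.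
  move=> s0; apply/eqP; apply: contraT => /set0Pn[f fD]; move: s0.
  rewrite (bigD1 f) //= => /eqP; rewrite gt_eqF // ltr_pwDl //.
    by rewrite weight_gt0 // (subsetP F'E) //; move: fD; rewrite inE => /andP[].
  apply: sumr_ge0 => h /andP[+ _]; rewrite inE => /andP[_ hF'].
  by rewrite ltW // weight_gt0 // (subsetP F'E).
rewrite lerD2l sumr_ge0 // => h; rewrite inE => /andP[_ hF'].
by rewrite ltW // weight_gt0 // (subsetP F'E).
Qed.

Lemma sum_compl_sub S T : S \subset T ->
  \sum_(v in S) (1 - x v) <= \sum_(v in T) (1 - x v) ?= iff (S == T).
Proof.
have y_gt0 v : 0 < 1 - x v by have := x_lt v; lra.
move=> ST; rewrite (big_setID S (A := T)) /= (setIidPr ST).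
rewrite -[X in X <= _ ?= iff _]addr0.
have -> : (S == T) = (T :\: S == set0) by rewrite setD_eq0 eqEsubset ST.
split; first by rewrite lerD2l sumr_ge0 // => h _; apply: ltW.
rewrite (inj_eq (addrI _)) eq_sym.
apply/eqP/eqP => [|->]; last by rewrite big_set0.
move=> s0; apply/eqP; apply: contraT => /set0Pn[f fD]; move: s0.
rewrite (bigD1 f) //= => /eqP; rewrite gt_eqF // ltr_pwDl //.
by apply: sumr_ge0 => h _; apply: ltW.
Qed.

Lemma sum_compl_gt1 S : (1 < #|S|)%N -> 1 < \sum_(v in S) (1 - x v).
Proof.
move=> S1; have /card_gt0P[u uS] : (0 < #|S|)%N by exact: ltnW.
have : \sum_(v in S) (1 / 2) < \sum_(v in S) (1 - x v).
  apply: ltr_sum => [|v _]; last by have := x_lt v; lra.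
  by apply/hasP; exists u; rewrite ?mem_index_enum.
apply: le_lt_trans; rewrite sumr_const.
have : (2 : R) <= #|S|%:R by rewrite ler_nat.
by rewrite -mulr_natr; lra.
Qed.

(** Vertices of [S] isolated in [induced S] only add positive weight to a valid constraint; if there
    is no edge at all, two vertices already weigh more than 1. *)
Lemma gap_induced_ge0 S : (1 < #|S|)%N -> 0 <= gap x S (induced S).
Proof.
move=> S1; have [->|nz] := eqVneq (induced S) set0.
  by rewrite /gap big_set0; have := sum_compl_gt1 S1; lra.
have := cover_gap_ge0 nz (induced_sub S).
have [+ _] := sum_compl_sub (cover_induced_sub S).
by rewrite /gap; lra.
Qed.

(** The size bound excludes singletons, whose gap [- x v] vanishes at every zero of [x]. *)
Definition tight S := (1 < #|S|)%N && (gap x S (induced S) == 0).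

Lemma tight_induced S : tight S -> induced S != set0.
Proof.
move=> /andP[S1 /eqP]; have [->|//] := eqVneq (induced S) set0.
by rewrite /gap big_set0; have := sum_compl_gt1 S1; lra.
Qed.

Lemma tight_edge f : f \in E -> tight f.
Proof.
move=> fE; rewrite /tight E2 //= /gap induced_edge // big_set1 big_split /=.
by rewrite sumr_const E2 // sumrN; apply/eqP; ring.
Qed.

Lemma tight_small S : tight S -> (#|S| <= 2)%N -> S \in E.
Proof.
move=> /tight_induced/set0Pn[f fS] S2; rewrite -(edge_eq fS S2).
by move: fS; rewrite inE => /andP[].
Qed.

(** An induced edge missing from [F] has positive weight, so adding it would make the gap
    negative. *)
Lemma cover_gap0 F : F != set0 -> F \subset E -> gap x (cover F) F = 0 ->
  tight (cover F) /\ F = induced (cover F).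
Proof.
move=> nz FE g0.
have FI : F \subset induced (cover F).
  apply/subsetP => f fF; rewrite inE (subsetP FE) //=.
  exact: (bigcup_max f).
have cov1 : (1 < #|cover F|)%N.
  have /set0Pn[f fF] := nz; rewrite -(E2 (subsetP FE f fF)) subset_leq_card //.
  exact: (bigcup_max f).
have [le eqc] := sum_weight_sub FI (induced_sub _).
have gI := gap_induced_ge0 cov1.
have FE' : F = induced (cover F).
  by apply/eqP; rewrite -eqc; move: g0 gI; rewrite /gap => g0 gI; apply/eqP; lra.
by split=> //; rewrite /tight cov1 -FE' g0 eqxx.
Qed.

(** Vertex weight is modular and induced edge weight supermodular, so the gaps of union and
    intersection add up to at most 0. Both being nonnegative, they vanish, and equality leaves no
    edge between [S :\: T] and [T :\: S]; then [linear_gap] is modular as well. *)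
Lemma uncross S T : tight S -> tight T -> (1 < #|S :&: T|)%N ->
  [/\ tight (S :|: T), tight (S :&: T) & forall d,
    linear_gap d (S :|: T) (induced (S :|: T)) +
    linear_gap d (S :&: T) (induced (S :&: T)) =
    linear_gap d S (induced S) + linear_gap d T (induced T)].
Proof.
move=> /andP[S1 /eqP gS] /andP[T1 /eqP gT] I1.
have U1 : (1 < #|S :|: T|)%N.
  by rewrite (leq_trans S1) // subset_leq_card // subsetUl.
have sumUI (W : finType) (X Y : {set W}) (a : W -> R) :
    \sum_(v in X :|: Y) a v = \sum_(v in X) a v + \sum_(v in Y) a v
      - \sum_(v in X :&: Y) a v.
  have -> : \sum_(v in X :|: Y) a v = \sum_(v in X) a v + \sum_(v in Y :\: X) a v.
    by rewrite (big_setID X) /= setUK setDUl setDv set0U.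
  by rewrite (big_setID X (A := Y)) /= [Y :&: X]setIC; ring.
have UE : induced S :|: induced T \subset induced (S :|: T).
  by rewrite subUset !inducedS ?subsetUl ?subsetUr.
have gU := gap_induced_ge0 U1; have gI := gap_induced_ge0 I1.
have [le eqc] := sum_weight_sub UE (induced_sub _).
have nE : \sum_(f in induced (S :|: T)) (1 - \sum_(u in f) x u) =
    \sum_(f in induced S :|: induced T) (1 - \sum_(u in f) x u).
  move: gS gT gU gI le; rewrite /gap sumUI inducedI.
  by rewrite [\sum_(f in _ :|: _) _]sumUI; lra.
have E_U : induced (S :|: T) = induced S :|: induced T.
  by apply/eqP; rewrite eq_sym -eqc nE.
have gUI : gap x (S :|: T) (induced (S :|: T)) + gap x (S :&: T) (induced (S :&: T))
    = gap x S (induced S) + gap x T (induced T).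
  by rewrite /gap E_U inducedI !sumUI; ring.
split.
- by rewrite /tight U1 /=; apply/eqP; lra.
- by rewrite /tight I1 /=; apply/eqP; lra.
- by move=> d; rewrite /linear_gap E_U inducedI !sumUI; ring.
Qed.

(** This shrinks tight sets that are not inside [U]. *)
Lemma tight_delete_leaf S z : tight S -> (2 < #|S|)%N -> z \in S -> x z = 0 ->
  (edge_deg (induced S) z <= 1)%N ->
  tight (S :\ z) /\ forall d, (forall v, x v = 0 -> d v = 0) ->
    linear_gap d (S :\ z) (induced (S :\ z)) = linear_gap d S (induced S).
Proof.
move=> /andP[S1 /eqP gS] S2 zS xz deg1.
have S'1 : (1 < #|S :\ z|)%N by move: S2; rewrite (cardsD1 z S) zS.
pose D := [set f in induced S | z \in f].
have iS : induced S = induced (S :\ z) :|: D.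
  apply/setP => f; rewrite !inE subsetD1; case: (f \in E); case: (f \subset S) => //=.
  by case: (z \in f).
have dis : [disjoint induced (S :\ z) & D].
  rewrite -setI_eq0; apply/eqP/setP => f; rewrite !inE subsetD1.
  by apply/negP => /and3P[/and3P[_ _ /negP zf] _ zf'].
have sumS (a : {set V} -> R) : \sum_(f in induced S) a f =
    \sum_(f in induced (S :\ z)) a f + \sum_(f in D) a f.
  by rewrite {1}iS -bigU //=; apply: eq_bigl => f; rewrite in_setU.
have sumV (a : V -> R) : \sum_(v in S) a v = a z + \sum_(v in S :\ z) a v.
  by rewrite (big_setD1 z).
have gS' := gap_induced_ge0 S'1.
(* An isolated [z] has weight 1, so [S :\ z] would have gap -1. *)
have [D0|[f Df]] := set_0Vmem D.
  by move: gS gS'; rewrite /gap sumS sumV D0 big_set0 xz; lra.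
have D1 : D = [set f] by apply/esym/eqP; rewrite eqEcard sub1set cards1 Df.
have [fE zf] : f \in E /\ z \in f by move: Df; rewrite !inE => /andP[/andP[]].
have [v [vz fv]] : exists v, v != z /\ f = [set z; v].
  have /cards1P[v fv] : #|f :\ z| == 1%N.
    by have /eqP := cardsD1 z f; rewrite zf (E2 fE) add1n eqSS eq_sym.
  have : v \in f :\ z by rewrite fv set11.
  rewrite !inE => /andP[vz _]; exists v; split=> //.
  by rewrite -(setD1K zf) fv.
have sumf (a : V -> R) : \sum_(u in f) a u = a z + a v.
  by rewrite fv big_setU1 ?big_set1 // inE eq_sym.
(* Deleting [z] with its only edge lowers the gap by [x v], from 0 to a nonnegative value. *)
have xv : x v = 0.
  move: gS gS' (x_ge0 v); rewrite /gap sumS sumV D1 big_set1 sumf xz; lra.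
split; first rewrite /tight S'1 /=; last move=> d d0.
  by apply/eqP; move: gS; rewrite /gap sumS sumV D1 big_set1 sumf xz xv; lra.
by rewrite /linear_gap sumS sumV D1 big_set1 sumf (d0 v) // (d0 z) //; lra.
Qed.

(** * Counting the independent equations inside [U] *)

Section Core.

Variables (U : {set V}) (L : {set {set V}}).
Hypothesis U_deg : forall z, z \in U -> x z = 0 ->
  (1 < edge_deg (induced U) z)%N.
Hypothesis U_edge : induced U != set0.
Hypothesis L_max : maxset
  (fun L => noncrossing L && [forall S in L, tight S && (S \subset U)]) L.

Lemma L_noncrossing : noncrossing L.
Proof. by have /maxsetp/andP[] := L_max. Qed.

Lemma L_sub S : S \in L -> S \subset U.
Proof. by have /maxsetp/andP[_ /forall_inP LP] := L_max => /LP/andP[]. Qed.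

Lemma L_tight S : S \in L -> tight S.
Proof. by have /maxsetp/andP[_ /forall_inP LP] := L_max => /LP/andP[]. Qed.

Lemma L_gt1 S : S \in L -> (1 < #|S|)%N.
Proof. by case/L_tight/andP. Qed.

Lemma L_add S : tight S -> S \subset U -> (forall T, T \in L -> ~~ cross S T) ->
  S \in L.
Proof.
move=> tS SU ncS; have /maxsetP[_ maxL] := L_max.
rewrite -(maxL (S |: L)) ?setU11 ?subsetUr //; apply/andP; split.
  apply/forall_inP => T; rewrite in_setU1 => /predU1P[->|TL].
    apply/forall_inP => W; rewrite in_setU1 => /predU1P[->|WL]; last exact: ncS.
    by rewrite /cross subxx andbF.
  apply/forall_inP => W; rewrite in_setU1 => /predU1P[->|WL].
    by rewrite crossC ncS.
  by have /forall_inP/(_ T TL)/forall_inP/(_ W WL) := L_noncrossing.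
apply/forall_inP => T; rewrite in_setU1 => /predU1P[->|TL]; first by rewrite tS.
by rewrite L_tight ?L_sub.
Qed.

(** A set sharing two vertices with an edge contains it, so edges cross nothing. *)
Lemma L_edge f : f \in induced U -> f \in L.
Proof.
rewrite inE => /andP[fE fU]; apply: L_add => // [|T TL]; first exact: tight_edge.
apply/negP => /and3P[I1 /negP fT _]; apply: fT; apply/setIidPl/eqP.
by rewrite eqEcard subsetIl E2.
Qed.

Lemma sum_induced_children (M : nmodType) A (b : {set V} -> M) :
  A \subset U -> A \notin E ->
  \sum_(f in induced A) b f =
  \sum_(C in children L A) \sum_(f in induced C) b f.
Proof.
move=> AU AE.
(* The edges inside [A] are members of [L], so the tree decomposition is applied to a function
   vanishing off [E]. *)
have := sum_children A (fun S => if S \in E then b S else 0) L_noncrossing L_gt1.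
have LE f S : S \subset U -> (f \in L) && (f \subset S) && (f \in E) = (f \in induced S).
  move=> SU; rewrite andbC andbA inE; case fS: (f \subset S); rewrite ?andbF // !andbT.
  case fE: (f \in E) => //=; apply/L_edge; rewrite inE fE.
  exact: subset_trans fS SU.
rewrite -big_mkcondr /=; under eq_bigl => f.
  have -> : (f \in L) && (f \proper A) && (f \in E) = (f \in induced A).
    rewrite -LE //; case fE: (f \in E); rewrite ?andbF // !andbT.
    rewrite properEneq; case: eqP => // fA.
    by rewrite -fA fE in AE.
  over.
move=> ->; apply: eq_bigr => C chC; rewrite -big_mkcondr /=.
apply: eq_bigl => f; apply: LE.
have [_ /proper_sub CA] := childrenP chC; exact: subset_trans CA AU.
Qed.

Lemma cover_children_sub A : cover (children L A) \subset A.
Proof. by apply/bigcupsP => C /childrenP[_ /proper_sub]. Qed.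

Lemma induced_cover_children A : A \subset U -> A \notin E ->
  induced (cover (children L A)) = induced A.
Proof.
move=> AU AE; apply/eqP; rewrite eqEsubset inducedS ?cover_children_sub //=.
apply/subsetP => f; rewrite !inE => /andP[fE fA]; rewrite fE /=.
have [||C chC fC] := @exists_child _ L A f.
- by apply: L_edge; rewrite inE fE (subset_trans fA).
- by rewrite properEneq fA andbT; apply: contraNneq AE => <-.
- exact: subset_trans fC (bigcup_max C _ _).
Qed.

(** The cover of the children has nonnegative gap, and each child, being tight, has edge weight
    equal to its vertex weight minus 1. *)
Lemma children_multiplicity A : A \subset U -> A \notin E -> induced A != set0 ->
  \sum_(v in cover (children L A)) (1 - x v) *+ multiplicity L A v <=
  \sum_(v in cover (children L A)) (1 - x v) + #|children L A|%:R - 1.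
Proof.
move=> AU AE /set0Pn[f]; rewrite -induced_cover_children // => fA.
have cov1 : (1 < #|cover (children L A)|)%N.
  by move: fA; rewrite inE => /andP[/E2 <-]; apply: subset_leq_card.
have := gap_induced_ge0 cov1.
rewrite /gap induced_cover_children // sum_induced_children //.
have -> : \sum_(C in children L A) \sum_(f in induced C) (1 - \sum_(u in f) x u)
    = \sum_(C in children L A) (\sum_(v in C) (1 - x v) - 1).
  apply: eq_bigr => C /childrenP[/L_tight/andP[_ /eqP + _]].
  by rewrite /gap; lra.
by rewrite [X in _ - X - 1]sumrB sumr_const sum_cover_children; lra.
Qed.

(* A member of [L] that is not essential gives an equation implied, for
   directions vanishing at the zeros of [x], by those of its children. *)
Definition essential A := [exists v, (x v != 0) && (1 < multiplicity L A v)%N].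

(** The share of [v] is at most twice its weight [1 - x v], with equality exactly at the zeros of
    [x]. *)
Definition doubled_zeros S := (\sum_(v in S) (x v == 0%R).+1)%N.

(** Twice the bound of [children_multiplicity], with doubled weights replaced by the integers of
    [doubled_zeros]. *)
Lemma count_step A : A \subset U -> A \notin E -> induced A != set0 ->
  (\sum_(C in children L A) doubled_zeros C + essential A + 2 <=
   doubled_zeros A + 2 * #|children L A|)%N.
Proof.
move=> AU AE A0; have := children_multiplicity AU AE A0.
set X := cover _; set r := multiplicity L A; set m := #|_| => le_y.
have -> : (\sum_(C in children L A) doubled_zeros C =
    \sum_(v in X) (x v == 0%R).+1 * r v)%N.
  apply: etrans (sum_cover_children L A (fun v => (x v == 0%R).+1)) _.
  by apply: eq_bigr => v _; rewrite -[LHS]mulr_natr natn.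
apply: (@leq_trans (\sum_(v in X) (x v == 0%R).+1 + 2 * m)); last first.
  rewrite leq_add2r /doubled_zeros [X in (_ <= X)%N](big_setID X) /=.
  by rewrite (setIidPr (cover_children_sub A)) leq_addr.
have le_c v : v \in X -> (((x v == 0).+1 * r v)%:R - (x v == 0).+1%:R : R) <=
    2 * ((1 - x v) *+ r v - (1 - x v)) ?= iff ((x v == 0) || (r v <= 1)%N).
  rewrite -multiplicity_gt0 -/r -(mulr_natr (1 - x v)) natrM.
  case: (r v) => // k _; have k_ge0 : (0 : R) <= k%:R by [].
  have := x_lt v; have [->|xv0] := eqVneq (x v) 0 => xlt /=.
    by split; [rewrite -natr1; lra|apply/eqP; rewrite -natr1; ring].
  split.
    rewrite -natr1 -subr_ge0 (_ : _ - _ = k%:R * (1 - 2 * x v)); last by ring.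
    by rewrite mulr_ge0 //; lra.
  rewrite -natr1 -subr_eq0 (_ : _ - _ = k%:R * (2 * x v - 1)); last by ring.
  rewrite mulf_eq0 pnatr_eq0 (_ : (2 * x v - 1 == 0) = false) ?orbF ?ltnS ?leqn0 //.
  by apply/eqP; lra.
have [le eqc] := leif_sum (P := mem X) le_c.
set a := (\sum_(v in X) _ * _)%N; set b := (\sum_(v in X) _.+1)%N.
set p := \sum_(v in X) (1 - x v) *+ _ in le_y *.
set q := \sum_(v in X) (1 - x v) in le_y *.
move: le eqc; rewrite sumrB -!natr_sum -/a -/b -mulr_sumr sumrB -/p -/q => le eqc.
have leab : (a%:R + 2 : R) <= b%:R + 2 * m%:R by lra.
(* A repeated vertex with [x v != 0] makes the comparison strict, and integrality turns this into a
   gain of 1. *)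
case ess: (essential A).
  have ne : a%:R - b%:R < 2 * (p - q).
    rewrite lt_neqAle le eqc andbT; apply/negP => /forall_inP all_r.
    have /existsP[v /andP[xv rv]] := ess.
    have vX : v \in X by rewrite -multiplicity_gt0 ltnW.
    by have := all_r v vX; rewrite (negPf xv) /= leqNgt rv.
  have : (a + 2 < b + 2 * m)%N by rewrite -(ltr_nat R) natrD [X in _ < X]natrD natrM; lra.
  by rewrite addn1 addSn.
by rewrite addn0 -(ler_nat R) natrD [X in _ <= X]natrD natrM.
Qed.

(* The edges record the degrees of the zeros: a zero counts 2 in
   [doubled_zeros U], and its at least two edges in [U] absorb this. *)
Definition excess S : nat :=
  if S \in E then (\sum_(v in S) (x v == 0%R))%N else essential S.

(** By induction down the tree: the 2 gained for each child cancels the term [2 * #|children L A|]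
    of [count_step]. *)
Lemma count_excess A : (A \in L) || (A == U) -> induced A != set0 ->
  (\sum_(S in L | S \subset A) excess S + 2 <= doubled_zeros A)%N.
Proof.
have [n ltn] := ubnP #|A|; elim: n A ltn => // n IH A ltAn LA A0.
have AU : A \subset U by case/orP: LA => [/L_sub|/eqP ->].
have [AE|AE] := boolP (A \in E).
  have -> : doubled_zeros A = (\sum_(v in A) (x v == 0%R) + 2)%N.
    rewrite /doubled_zeros; under eq_bigr do rewrite -addn1.
    by rewrite big_split /= sum1_card E2.
  rewrite leq_add2r [X in (_ <= X)%N](_ : _ = excess A); last by rewrite /excess AE.
  rewrite (big_pred1 A) // => S; apply/andP/eqP => [[SL SA]|->].
    by apply/eqP; rewrite eqEcard SA E2 // L_gt1.
  by split=> //; apply: L_edge; rewrite inE AE.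
have := count_step AU AE A0.
have : (\sum_(C in children L A) (\sum_(S in L | S \subset C) excess S + 2) <=
    \sum_(C in children L A) doubled_zeros C)%N.
  apply: leq_sum => C /childrenP[CL CA]; apply: IH; last exact/tight_induced/L_tight.
    by apply: leq_trans (proper_card CA) _.
  by rewrite CL.
have sum_ch : (\sum_(S in L | S \proper A) excess S =
    \sum_(C in children L A) \sum_(S in L | S \subset C) excess S)%N.
  exact: sum_children L_noncrossing L_gt1.
rewrite big_split /= sum_nat_const -sum_ch.
have : (\sum_(S in L | S \subset A) excess S <=
    \sum_(S in L | S \proper A) excess S + essential A)%N.
  have excA : excess A = essential A by rewrite /excess (negPf AE).
  case AL: (A \in L).
    rewrite (bigD1 A) /= ?AL ?subxx // excA addnC leq_add2r.
    rewrite (eq_bigl (fun S => (S \in L) && (S \proper A))) // => S.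
    by rewrite properEneq -andbA [_ && (S != A)]andbC.
  rewrite -[X in (X <= _)%N]addn0 leq_add //.
  rewrite (eq_bigl (fun S => (S \in L) && (S \proper A))) // => S.
  rewrite properEneq; case: eqP => [->|] //=.
  by rewrite AL.
move: (bigop _ _ _) (bigop _ _ _) (bigop _ _ _) (doubled_zeros A) #|_| (nat_of_bool _).
clear; lia.
Qed.

Lemma count_essential :
  (#|[set S in L | (S \notin E) && essential S]| <
   #|[set v in U | x v != 0%R]|)%N.
Proof.
have := count_excess (A := U); rewrite eqxx orbT U_edge => /(_ isT isT).
have -> : doubled_zeros U =
    (#|[set v in U | x v != 0%R]| + 2 * #|[set v in U | x v == 0%R]|)%N.
  rewrite /doubled_zeros (bigID (fun v => x v == 0)) /= addnC; congr (_ + _)%N.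
    rewrite -sum1_card; apply: eq_big => v; first by rewrite inE.
    by case/andP => _ /negPf ->.
  rewrite -sum1_card big_distrr /=; apply: eq_big => v; first by rewrite inE.
  by case/andP => _ ->.
have -> : (\sum_(S in L | S \subset U) excess S =
    \sum_(f in induced U) \sum_(v in f) (x v == 0%R) +
    #|[set S in L | (S \notin E) && essential S]|)%N.
  rewrite (bigID (fun S => S \in E)) /=; congr (_ + _)%N.
    apply: eq_big => [S|S /andP[_ SE]]; last by rewrite /excess SE.
    apply/idP/idP => [/andP[/andP[_ SU] SE]|SU]; first by rewrite inE SE.
    by rewrite L_edge //; move: SU; rewrite inE => /andP[-> ->].
  rewrite -sum1_card [RHS](eq_bigl
    (fun S => [&& S \in L, S \subset U & S \notin E] && essential S)); last first.
    move=> S; rewrite inE; case SL: (S \in L) => //=.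
    by rewrite (L_sub SL).
  rewrite [RHS]big_mkcondr; apply: eq_big => [S|S /andP[_ /negPf SE]].
    by rewrite andbA.
  by rewrite /excess SE; case: essential.
(* The right side sums the degrees in [U] of its zeros, each at least 2. *)
suff : (2 * #|[set v in U | x v == 0%R]| <=
    \sum_(f in induced U) \sum_(v in f) (x v == 0%R))%N by lia.
rewrite (exchange_big_dep xpredT) //=.
rewrite mulnC -sum_nat_const.
rewrite [X in (_ <= X)%N](bigID (fun v => v \in [set v in U | x v == 0])) /=.
apply: leq_trans (leq_addr _ _).
apply: leq_sum => v; rewrite inE => /andP[vU /eqP xv].
apply: leq_trans (U_deg vU xv) _; rewrite xv eqxx /edge_deg -sum1_card.
by rewrite (eq_bigl (fun f => (f \in induced U) && (v \in f))) // => f; rewrite inE.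
Qed.

(** * Directions that preserve all tight constraints *)

Section Direction.

Variable d : V -> R.
Hypothesis d_supp : forall v, x v = 0 -> d v = 0.
Hypothesis d_essential : forall S, S \in L -> S \notin E -> essential S ->
  linear_gap d S (induced S) = 0.

Lemma linear_gap_L S : S \in L -> linear_gap d S (induced S) = 0.
Proof.
have [n ltn] := ubnP #|S|; elim: n S ltn => // n IH S ltSn SL.
have [SE|SE] := boolP (S \in E); first exact: linear_gap_edge.
have [/d_essential->//|/existsPn noness] := boolP (essential S).
have S0 := tight_induced (L_tight SL); have SU := L_sub SL.
(* The cover induces the same edges as the tight [S]; a vertex left out would make its gap
   negative. *)
have cov : cover (children L S) = S.
  have [f fS] := set0Pn _ S0.
  have cov1 : (1 < #|cover (children L S)|)%N.
    move: fS; rewrite -induced_cover_children // inE => /andP[/E2 <-].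
    exact: subset_leq_card.
  have [le eqc] := sum_compl_sub (cover_children_sub S).
  apply/eqP; rewrite -eqc; apply/eqP.
  have := gap_induced_ge0 cov1; rewrite /gap induced_cover_children //.
  by have /andP[_ /eqP] := L_tight SL; rewrite /gap; lra.
rewrite /linear_gap sum_induced_children //.
(* Children overlap only at zeros of [x], where [d] vanishes. *)
have -> : \sum_(v in S) d v = \sum_(C in children L S) \sum_(v in C) d v.
  rewrite sum_cover_children cov; apply: eq_bigr => v.
  rewrite -{1}cov -multiplicity_gt0 => r_gt0.
  have := noness v; rewrite negb_and negbK -leqNgt.
  case/orP => [/eqP/d_supp ->|r1]; first by rewrite mul0rn.
  by rewrite (_ : multiplicity L S v = 1%N) //; apply/eqP; rewrite eqn_leq r1.
rewrite -sumrB big1 // => C /childrenP[CL CS].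
by apply: IH => //; apply: leq_trans (proper_card CS) _.
Qed.

(* If a minimal member (or [U]) contains a violated tight set, then a largest
   violated one inside it crosses no member of [L]. *)
Lemma linear_gap_core S : tight S -> S \subset U ->
  linear_gap d S (induced S) = 0.
Proof.
have bad_in A : (A \in L) || (A == U) -> forall S, tight S -> S \subset A ->
    linear_gap d S (induced S) = 0.
  have [n ltn] := ubnP #|A|; elim: n A ltn => // n IH A ltAn LA.
  have AU : A \subset U by case/orP: LA => [/L_sub|/eqP ->].
  have ncA T : T \in L -> ~~ cross A T.
    move=> TL; case/orP: LA => [AL|/eqP ->]; last by rewrite /cross (L_sub TL) !andbF.
    by have /forall_inP/(_ A AL)/forall_inP/(_ T TL) := L_noncrossing.
  move=> {}S; have [k ltk] := ubnP (#|A| - #|S|).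
  elim: k S ltk => // k IHk S ltk tS SA.
  have SU := subset_trans SA AU.
  have [/existsP[T /andP[TL crST]]|/existsPn ncS] :=
    boolP [exists T, (T \in L) && cross S T]; last first.
    apply/linear_gap_L/L_add => // T TL.
    by have := ncS T; rewrite TL.
  have /and3P[I1 ST TS] := crST.
  (* [A] meets [T] in two vertices and is not inside [T], so noncrossing forces [T] inside [A]. *)
  have TA : T \proper A.
    have := ncA T TL; rewrite /cross properE.
    rewrite (leq_trans I1) /=; last by rewrite subset_leq_card // setSI.
    have AT : ~~ (A \subset T) by apply: contra ST; apply: subset_trans.
    by rewrite AT /= negbK andbT.
  have [tU tI] := uncross tS (L_tight TL) I1.
  move=> /(_ d); rewrite (linear_gap_L TL) addr0 => <-.
  rewrite (IH T _ _ (S :&: T)) ?TL ?subsetIr //; last first.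
    exact: leq_trans (proper_card TA) _.
  rewrite addr0; apply: IHk => //; last by rewrite subUset SA proper_sub.
  have ltU : (#|S| < #|S :|: T|)%N.
    by apply: proper_card; rewrite properE subsetUl subUset subxx /= TS.
  have leU : (#|S :|: T| <= #|A|)%N.
    by rewrite subset_leq_card // subUset SA proper_sub.
  exact: leq_trans (ltn_sub2l (leq_trans ltU leU) ltU) ltk.
by move=> tS; apply: (bad_in U) => //; rewrite eqxx orbT.
Qed.

Hypothesis U_max : forall S, U \subset S ->
  (forall z, z \in S -> x z = 0 -> (1 < edge_deg (induced S) z)%N) -> S = U.

Lemma edge_degS S T z : S \subset T ->
  (edge_deg (induced S) z <= edge_deg (induced T) z)%N.
Proof.
move=> ST; apply: subset_leq_card; apply/subsetP => f; rewrite !in_set.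
case/andP=> /andP[-> fS] ->; rewrite andbT; exact: subset_trans fS ST.
Qed.

(** If [S] is not inside [U], maximality of [U] gives a zero of degree at most one in [S :|: U]. It
    lies in [S], as zeros in [U] have degree at least two, and can be deleted from [S]. *)
Lemma linear_gap_tight S : tight S -> linear_gap d S (induced S) = 0.
Proof.
have [n ltn] := ubnP #|S|; elim: n S ltn => // n IH S ltSn tS.
have [SU|SU] := boolP (S \subset U); first exact: linear_gap_core.
have [S2|S2] := leqP #|S| 2; first exact/linear_gap_edge/tight_small.
have /existsP[z /and3P[zSU /eqP xz deg]] : [exists z, [&& z \in S :|: U, x z == 0 &
    (edge_deg (induced (S :|: U)) z <= 1)%N]].
  apply: contraNT SU => /existsPn noz; apply/setUidPr/U_max; first exact: subsetUr.
  by move=> z zSU xz; have := noz z; rewrite zSU xz eqxx /= -ltnNge.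
have zS : z \in S.
  move: zSU; rewrite inE => /orP[//|zU]; have := U_deg zU xz.
  by rewrite ltnNge (leq_trans (edge_degS _ (subsetUr S U))).
have [tS' /(_ d d_supp) <-] := tight_delete_leaf tS S2 zS xz
  (leq_trans (edge_degS _ (subsetUl S U)) deg).
by apply: IH => //; move: ltSn; rewrite (cardsD1 z S) zS.
Qed.

End Direction.

End Core.

End Gap.

(** * Translation to the polyhedron and the final perturbation *)

Lemma linear_gapE (R : realFieldType) (V : finType) (d : V -> R) (S : {set V})
    (F : {set {set V}}) :
  linear_gap d S F = \sum_v d v * ((v \in S)%:R - \sum_(f in F) (v \in f)%:R).
Proof.
have sum_mem (T : {set V}) : \sum_(v in T) d v = \sum_v d v * (v \in T)%:R.
  rewrite big_mkcond; apply: eq_bigr => v _.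
  by case: (v \in T); rewrite ?mulr1 ?mulr0.
under [RHS]eq_bigr do rewrite mulrBr.
rewrite sumrB -sum_mem /linear_gap; congr (_ - _).
under [RHS]eq_bigr do rewrite mulr_sumr.
by rewrite exchange_big; apply: eq_bigr => f _; rewrite sum_mem.
Qed.

(** Counting incidences by edges or by vertices turns edge weights into degrees. *)
Lemma SD_gap (R : realFieldType) (V : finType) (x : V -> R) (F : {set {set V}}) :
  (\sum_(u in cover F) ((edge_deg F u)%:R - 1) * x u >=
     #|F|%:R - #|cover F|%:R + 1) = (0 <= gap x (cover F) F).
Proof.
have deg_sum : \sum_(f in F) \sum_(u in f) x u =
    \sum_(u in cover F) (edge_deg F u)%:R * x u.
  rewrite (exchange_big_dep (fun u => u \in cover F)) /=; last first.
    by move=> f u fF uf; apply/bigcupP; exists f.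
  apply: eq_bigr => u _; rewrite sumr_const mulr_natl; congr (_ *+ _).
  by apply: eq_card => f; rewrite inE.
rewrite -subr_ge0; congr (0 <= _); rewrite /gap !sumrB deg_sum !sumr_const.
under eq_bigr do rewrite mulrBl mul1r.
by rewrite sumrB; ring.
Qed.

Lemma edge_set2 (V : finType) (e : rel V) : irreflexive e ->
  forall f, f \in edge_set e -> #|f| = 2%N.
Proof.
move=> e_irr f; rewrite inE => /existsP[u /existsP[v /andP[uv /eqP ->]]].
by rewrite cards2; case: eqP uv => // ->; rewrite e_irr.
Qed.

Lemma cycle_edge_deg (V : finType) (e : rel V) (p : seq V) (z : V) :
  symmetric e -> irreflexive e -> (2 < size p)%N -> ucycle e p -> z \in p ->
  (1 < edge_deg (induced (edge_set e) [set v in p]) z)%N.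
Proof.
move=> e_sym e_irr p2 /andP[cyc uniq_p] zp.
have inc u : u \in p -> e z u ->
    [set z; u] \in [set f in induced (edge_set e) [set v in p] | z \in f].
  move=> up zu; rewrite !inE eqxx andbT; apply/andP; split.
    by apply/existsP; exists z; apply/existsP; exists u; rewrite zu eqxx.
  by apply/subsetP => v; rewrite !inE => /orP[] /eqP ->.
(* Otherwise two steps along the cycle return to [z], impossible beyond length 2. *)
have ne : next p z != prev p z.
  apply/eqP => /(congr1 (next p)); rewrite next_prev //.
  have [i q rot_p] := rot_to zp; rewrite -!(next_rot i uniq_p) rot_p.
  have : uniq (z :: q) by rewrite -rot_p rot_uniq.
  have : (2 < size (z :: q))%N by rewrite -rot_p size_rot.
  case: q {rot_p} => [|a [|b q]] //= _; rewrite !inE !negb_or eqxx.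
  case/andP => /and3P[/negPf za zb _] _.
  by rewrite eq_sym za eqxx => bz; rewrite bz eqxx in zb.
apply: (@leq_trans #|[set [set z; next p z]; [set z; prev p z]]|); last first.
  apply/subset_leq_card/subsetP => f; rewrite in_set2 => /orP[] /eqP ->.
    by apply: inc; rewrite ?mem_next // next_cycle.
  by apply: inc; rewrite ?mem_prev // e_sym prev_cycle.
rewrite cards2 ltnS lt0b; apply: contra ne => /eqP eq_f.
have zne u : e z u -> u != z by apply: contraTneq => ->; rewrite e_irr.
have : next p z \in [set z; prev p z] by rewrite -eq_f set22.
by rewrite in_set2 (negPf (zne _ _)) ?next_cycle.
Qed.

Theorem theorem2 (R : realType) (V : finType) (e : rel V)
    (e_sym : symmetric e) (e_irr : irreflexive e) (e_cycle : has_cycle e)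
    (x : {ffun V -> R^o}) (x_ext : extreme_point (edge_SD_polyhedron e) x) :
  exists u : V, 1 / 2 <= (x u : R).
Proof.
apply/existsP; apply: contraT => /existsPn x_small.
have [[x_01 x_SD] ext] := x_ext; exfalso.
set E := edge_set e in x_SD *; have E2 := edge_set2 e_irr.
pose xf v : R := x v.
have x_ge0 v : 0 <= xf v by have /andP[] := x_01 v.
have x_lt v : xf v < 1 / 2 by rewrite ltNge x_small.
have gap_ge0 (F : {set {set V}}) : F != set0 -> F \subset E -> 0 <= gap xf (cover F) F.
  by move=> F0 FE; rewrite -SD_gap; apply: x_SD.
have [p p2 cyc] := e_cycle.
pose core (S : {set V}) :=
  [forall z in S, (xf z == 0) ==> (1 < edge_deg (induced E S) z)%N].
have [|U maxU pU] := @maxset_exists _ core [set v in p].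
  apply/forall_inP => z; rewrite inE => zp; apply/implyP => _.
  exact: cycle_edge_deg.
have U_deg z : z \in U -> xf z = 0 -> (1 < edge_deg (induced E U) z)%N.
  have /maxsetp/forall_inP/(_ z) := maxU.
  by move=> + zU xz => /(_ zU); rewrite xz eqxx.
have U_max (S : {set V}) : U \subset S ->
    (forall z, z \in S -> xf z = 0 -> (1 < edge_deg (induced E S) z)%N) -> S = U.
  have /maxsetP[_ maxU'] := maxU => US degS; apply: maxU' => //.
  by apply/forall_inP => z zS; apply/implyP => /eqP; apply: degS.
have U_edge : induced E U != set0.
  have [z zp] : exists z, z \in p by case: (p) p2 => // z q _; exists z; rewrite mem_head.
  have /card_gt0P[f] := ltnW (cycle_edge_deg e_sym e_irr p2 cyc zp).
  rewrite inE => /andP[fp _]; apply/set0Pn; exists f.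
  exact: subsetP (inducedS _ pU) f fp.
have [|L L_max _] := @maxset_exists _ (fun L => noncrossing L &&
    [forall S in L, tight E xf S && (S \subset U)]) set0.
  by apply/andP; split; apply/forall_inP => S; rewrite inE.
have := count_essential E2 x_lt gap_ge0 U_deg U_edge L_max.
case/(exists_supported_kernel (fun (S : {set V}) v =>
  (v \in S)%:R - \sum_(f in induced E S) (v \in f)%:R : R)) => d [[v0 d0] dD dK].
have d_supp v : xf v = 0 -> d v = 0.
  by move=> xv; apply: dD; rewrite inE xv eqxx andbF.
have d_tight (S : {set V}) : tight E xf S -> linear_gap d S (induced E S) = 0.
  apply: (linear_gap_tight E2 x_ge0 x_lt gap_ge0 U_deg L_max d_supp _ U_max).
  by move=> T TL TE essT; rewrite linear_gapE dK // inE TL TE.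
pose valid (F : {set {set V}}) := (F != set0) && (F \subset E).
(* One index per constraint: [inl] for the bounds [0 <= x v], [inr] for edge sets, with the harmless
   value 0 at invalid ones. *)
have [||eps eps_gt0 eps_le] := @exists_common_scale R (V + {set {set V}})%type
    (fun i => match i with
       inl v => xf v | inr F => if valid F then gap xf (cover F) F else 0 end)
    (fun i => match i with
       inl v => d v | inr F => if valid F then linear_gap d (cover F) F else 0 end).
- case=> [v|F] //; case: ifP => // /andP[]; exact: gap_ge0.
- case=> [v|F]; first exact: d_supp.
  case: ifP => // /andP[F0 FE] g0.
  have [tF FI] := cover_gap0 E2 x_lt gap_ge0 F0 FE g0.
  by rewrite {2}FI d_tight.
have in_poly s : `|s| = eps -> edge_SD_polyhedron e [ffun v => xf v + s * d v].
  move=> s_eps; split=> [v|F F0 FE].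
    (* The shift is at most [xf v] in absolute value, so the new entry is between 0 and [2 * xf v],
       which is below 1. *)
    rewrite ffunE; have := eps_le (inl v).
    by rewrite -s_eps -normrM ler_norml; have := x_lt v; lra.
  have -> : \sum_(u in cover F) ((edge_deg F u)%:R - 1) *
      ([ffun v => xf v + s * d v] u : R) =
    \sum_(u in cover F) ((edge_deg F u)%:R - 1) * (xf u + s * d u).
    by apply: eq_bigr => u _; rewrite ffunE.
  rewrite SD_gap gap_shift.
  have := eps_le (inr F); rewrite /valid F0 FE /=.
  by rewrite -s_eps -normrM ler_norml; lra.
have half : 0 < (1 / 2 : R) < 1 by lra.
(* [x] is the midpoint of the two shifted points, so extremality would force [eps * d v0 = 0]. *)
have := ext [ffun v => xf v + eps * d v] [ffun v => xf v + (- eps) * d v] (1 / 2)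
  (in_poly eps _) (in_poly (- eps) _) half.
rewrite normrN gtr0_norm // => /(_ erefl erefl).
case=> [|/ffunP/(_ v0) + _].
  by apply/ffunP => v; rewrite !ffunE /GRing.scale /= /xf; lra.
rewrite ffunE => /eqP; rewrite -subr_eq0 /xf addrC addKr mulf_eq0 (negPf d0) orbF.
by rewrite gt_eqF.
Qed.
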